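(* If two horizontally regular curves in $H^1$ differ by a Heisenberg rigid motion, then their projections on the $xy$-plane differ by a Euclidean rigid motion. In particular, two horizontal curves in $H^1$ differ by a Heisenberg rigid motion if and only if their projections on the $xy$-plane are congruent in the Euclidean plane.
   Context: $H^1$ is $\mathbb{R}^3$ with group law $(x_1,y_1,z_1)\circ(x_2,y_2,z_2)=(x_1+x_2,\,y_1+y_2,\,z_1+z_2+y_1x_2-x_1y_2)$ and left invariant vector fields $\mathring e_1=\partial_x+y\,\partial_z$, $\mathring e_2=\partial_y-x\,\partial_z$, $T=\partial_z$. The contact form is $\theta_0=dz+x\,dy-y\,dx$, the contact bundle is $\xi_0=\ker\theta_0=\mathrm{span}(\mathring e_1,\mathring e_2)$, and $J_0\mathring e_1=\mathring e_2$, $J_0\mathring e_2=-\mathring e_1$. A Heisenberg rigid motion is an element of $PSH(1)$, the group of pseudohermitian transformations: diffeomorphisms $\Phi$ of $H^1$ with $\Phi^*\theta_0=\theta_0$ and $\Phi_*J_0=J_0\Phi_*$ on $\xi_0$. Two curves $\gamma_1,\gamma_2$ differ by a Heisenberg rigid motion if $\gamma_2=g\circ\gamma_1$ for some $g\in PSH(1)$. A parametrized curve $\gamma:(a,b)\to H^1$ is horizontally regular if the $\xi_0$-component $\gamma'_{\xi_0}$ of $\gamma'$ (in the splitting $TH^1=\xi_0\oplus\mathbb{R}T$) never vanishes, and horizontal if $\gamma'(t)=\gamma'_{\xi_0}(t)$ for each $t\in(a,b)$. The projection on the $xy$-plane is $\pi(x,y,z)=(x,y)$, applied to a curve as $\pi\circ\gamma$.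 *)

(* Defs.v *)
From mathcomp Require Import all_boot all_order all_algebra.
From mathcomp Require Import all_classical all_reals all_analysis.
From mathcomp Require Import ring.
Set Implicit Arguments.
Unset Strict Implicit.
Unset Printing Implicit Defensive.
Import Order.TTheory GRing.Theory Num.Theory.
Import numFieldNormedType.Exports.
Local Open Scope classical_set_scope.
Local Open Scope ring_scope.

(** [f] is of class [C^k] on the open set [U].  Differentiability is Frechet;
    in finite dimension, asking every directional derivative to be [C^(k-1)]
    is the same as asking the differential to be [C^(k-1)]. *)
Fixpoint Ck_on (R : realType) (V W : normedModType R) (U : set V) (k : nat)
    (f : V -> W) : Prop :=
  if k is k'.+1 then
    (forall x, U x -> differentiable f x) /\ (forall v, Ck_on U k' ('D_v f))
  else forall x, U x -> {for x, continuous f}.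

Definition smooth_on (R : realType) (V W : normedModType R) (U : set V)
    (f : V -> W) : Prop :=
  forall k, Ck_on U k f.

Definition diffeomorphism (R : realType) (V W : normedModType R)
    (f : V -> W) : Prop :=
  smooth_on setT f /\
  exists2 g : W -> V, cancel f g /\ cancel g f & smooth_on setT g.

(** Points of [H^1], and tangent vectors at each point, are row vectors
    [(x, y, z)] in the coordinate frame [d/dx, d/dy, d/dz]. *)
Notation H1 R := 'rV[R]_3.

Section Heisenberg.
Variable R : realType.
Implicit Types (p q v : H1 R).

Definition vec3 (x y z : R) : H1 R := \row_(i < 3) [:: x; y; z]`_i.

Definition xc p : R := p 0 0.
Definition yc p : R := p 0 1.
Definition zc p : R := p 0 2.

Definition heis_mul p q : H1 R :=
  vec3 (xc p + xc q) (yc p + yc q)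
       (zc p + zc q + yc p * xc q - xc p * yc q).

Definition e1 p : H1 R := vec3 1 0 (yc p).
Definition e2 p : H1 R := vec3 0 1 (- xc p).
Definition Tfield p : H1 R := vec3 0 0 1.

(** [dz + x dy - y dx] at [p], applied to [v]. *)
Definition theta0 p v : R := zc v + xc p * yc v - yc p * xc v.

Definition xi0 p : set (H1 R) := [set v | theta0 p v = 0].

(** By [xi0E] below, on [xi0 p] this is the linear map sending [e1] to [e2] and
    [e2] to [- e1]; its values off [xi0 p] are irrelevant. *)
Definition J0 p v : H1 R := xc v *: e2 p - yc v *: e1 p.

(** The component along [xi0] in the splitting [xi0 p (+) R T]. *)
Definition xi0_part p v : H1 R := v - theta0 p v *: Tfield p.

Definition PSH1 (Phi : H1 R -> H1 R) : Prop :=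
  [/\ diffeomorphism Phi,
      forall p v, theta0 (Phi p) ('d Phi p v) = theta0 p v
    & forall p v, xi0 p v -> 'd Phi p (J0 p v) = J0 (Phi p) ('d Phi p v)].

Definition proj_xy p : 'rV[R]_2 := \row_(i < 2) [:: xc p; yc p]`_i.

Lemma vec3E x y z :
  (xc (vec3 x y z) = x) * (yc (vec3 x y z) = y) * (zc (vec3 x y z) = z).
Proof. by rewrite /xc /yc /zc !mxE. Qed.

Lemma vec3P p : p = vec3 (xc p) (yc p) (zc p).
Proof.
apply/rowP => i; rewrite mxE /xc /yc /zc.
case: i => [[|[|[|//]]] lt_i3] /=; congr (p 0 _); exact: val_inj.
Qed.

(** Left invariance of the frame: left translations are affine, so their
    differentials are read off from increments. *)
Lemma e1_left_invariant q p (t : R) :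
  heis_mul q (p + t *: e1 p) = heis_mul q p + t *: e1 (heis_mul q p).
Proof.
rewrite /heis_mul /e1 !vec3E /xc /yc /zc; apply/rowP => i; rewrite !mxE.
by case: i => [[|[|[|//]]] lt_i3] /=; ring.
Qed.

Lemma e2_left_invariant q p (t : R) :
  heis_mul q (p + t *: e2 p) = heis_mul q p + t *: e2 (heis_mul q p).
Proof.
rewrite /heis_mul /e2 !vec3E /xc /yc /zc; apply/rowP => i; rewrite !mxE.
by case: i => [[|[|[|//]]] lt_i3] /=; ring.
Qed.

Lemma xi0E p v : xi0 p v <-> v = xc v *: e1 p + yc v *: e2 p.
Proof.
split=> [|->]; rewrite /xi0 /theta0 /=; last first.
  by rewrite /xc /yc /zc !mxE /= /xc /yc; ring.
move=> h; rewrite [LHS]vec3P; apply/rowP => i; rewrite !mxE.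
case: i => [[|[|[|//]]] lt_i3] /=; [ring | ring |].
by apply/eqP; rewrite -subr_eq0 -h; apply/eqP; ring.
Qed.

Lemma J0_e1 p : J0 p (e1 p) = e2 p.
Proof. by rewrite /J0 !vec3E scale1r scale0r subr0. Qed.

Lemma J0_e2 p : J0 p (e2 p) = - e1 p.
Proof. by rewrite /J0 !vec3E scale1r scale0r add0r. Qed.

Lemma theta0_T p : theta0 p (Tfield p) = 1.
Proof. by rewrite /theta0 !vec3E; ring. Qed.

Lemma xi0_part_xi0 p v : xi0 p (xi0_part p v).
Proof. by rewrite /xi0 /= /xi0_part /theta0 /xc /yc /zc !mxE /=; ring. Qed.

End Heisenberg.

Section Curves.
Variable R : realType.
Implicit Types (a b : \bar R) (gamma : R -> H1 R).

Definition oitv a b : set R := [set t | (a < t%:E < b)%E].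

Definition horizontally_regular a b gamma : Prop :=
  forall t, oitv a b t -> xi0_part (gamma t) (derive1 gamma t) <> 0.

Definition horizontal a b gamma : Prop :=
  forall t, oitv a b t -> derive1 gamma t = xi0_part (gamma t) (derive1 gamma t).

Definition differ_by_heisenberg_motion a b gamma1 gamma2 : Prop :=
  exists2 g, PSH1 g & forall t, oitv a b t -> gamma2 t = g (gamma1 t).

(** Euclidean rigid motions preserve orientation: elements of [PSH(1)] induce
    only such motions, and a horizontal curve over a plane curve is in general
    not carried by [PSH(1)] to one over the reflected plane curve. *)
Definition euclidean_rigid_motion (E : 'rV[R]_2 -> 'rV[R]_2) : Prop :=
  exists (A : 'M[R]_2) (c : 'rV[R]_2),
    [/\ A *m A^T = 1%:M, \det A = 1 & forall p, E p = p *m A + c].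

Definition differ_by_euclidean_motion a b (c1 c2 : R -> 'rV[R]_2) : Prop :=
  exists2 E, euclidean_rigid_motion E &
    forall t, oitv a b t -> c2 t = E (c1 t).

End Curves.

(* Main.v *)
Require Import Defs.
From mathcomp Require Import all_boot all_order all_algebra.
From mathcomp Require Import all_classical all_reals all_analysis.
From mathcomp Require Import ring lra.
Set Implicit Arguments.
Unset Strict Implicit.
Unset Printing Implicit Defensive.
Import Order.TTheory GRing.Theory Num.Theory.
Import numFieldNormedType.Exports.
Local Open Scope classical_set_scope.
Local Open Scope ring_scope.

(** A pseudohermitian [Phi = (f, g, h)] preserves [theta0], hence also
    [d theta0 = 2 dx /\ dy]; so [f] and [g] do not depend on [z] and
    [(x, y) |-> (f, g)] preserves area.  Commutation with [J0] is the
    Cauchy-Riemann system, so [f + i g] is holomorphic with a derivative of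
    modulus 1, which is therefore constant: [(f, g)] is a Euclidean motion.
    Conversely, a Euclidean motion lifts to a rotation about the z-axis followed
    by a left translation whose z-component is free.  Since [z' = y x' - x y']
    along a horizontal curve, the heights of the two curves then differ by a
    constant, which that z-component absorbs. *)

(** * Directional derivatives: mean value theorems along lines and symmetry of second derivatives *)

Section Calculus.
Variables (R : realType) (V : normedModType R).
Implicit Types (f : V -> R) (u v w p : V).

(** The two difference quotients coincide, so one-variable theorems apply along lines. *)
Lemma is_derive_line f p v (t : R) : derivable f (t *: v + p) v ->
  is_derive t 1 (fun s : R => f (s *: v + p)) ('D_v f (t *: v + p)).
Proof.
rewrite /derivable => df.
have e : (fun h : R => h^-1 *: (f ((h *: 1 + t) *: v + p) - f (t *: v + p))) =
  (fun h : R => h^-1 *: (f (h *: v + (t *: v + p)) - f (t *: v + p))).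
  by apply/funext => h; rewrite scalerDl -addrA /GRing.scale /= mulr1.
by split; rewrite /derivable /derive /= e.
Qed.

Lemma diff_is_derive f p v : differentiable f p ->
  is_derive p v f ('D_v f p).
Proof. by move=> df; apply: derivableP; exact: diff_derivable. Qed.

Lemma is_derive_unique f1 f2 p v d1 d2 : is_derive p v f1 d1 ->
  is_derive p v f2 d2 -> f1 =1 f2 -> d1 = d2.
Proof. by move=> [_ <-] [_ <-] /funext ->. Qed.

Lemma derive_unit_circle f1 f2 p v d1 d2 : is_derive p v f1 d1 ->
  is_derive p v f2 d2 -> (forall q, f1 q * f1 q + f2 q * f2 q = 1) ->
  f1 p * d1 + f1 p * d1 + (f2 p * d2 + f2 p * d2) = 0.
Proof.
move=> df1 df2 E.
exact: (is_derive_unique (is_deriveD (is_deriveM df1 df1) (is_deriveM df2 df2))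
  (is_derive_cst (1 : R) p v)).
Qed.

Lemma derive_eq0_cst f : (forall p v, is_derive p v f 0) ->
  forall p q, f p = f q.
Proof.
move=> df p q.
have := @is_derive_0_is_cst R (fun s : R => f (s *: (q - p) + p)) 0 1.
rewrite scale0r add0r scale1r subrK; apply => t.
have [d0 d0E] := df (t *: (q - p) + p) (q - p).
by rewrite -d0E; exact: is_derive_line.
Qed.

Lemma MVT_line f p v (s : R) : (forall p, derivable f p v) -> 0 < s ->
  exists2 r, 0 < r < s & f (s *: v + p) - f p = s * 'D_v f (r *: v + p).
Proof.
move=> df s0.
have [||r rs E] := @MVT R (fun s : R => f (s *: v + p))
    (fun s => 'D_v f (s *: v + p)) 0 s s0.
- by move=> t _; exact: is_derive_line.
- apply: derivable_within_continuous => t _.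
  by have [] := is_derive_line (df (t *: v + p)).
- exists r; first by rewrite in_itv in rs.
  by move: E; rewrite scale0r add0r subr0 mulrC.
Qed.

(** Mean value theorem twice: along [u] for the increment [f (s *: v + p) - f p] as a function of
    [p], then along [v] for ['D_u f]. *)
Lemma MVT2_line f p u v (s : R) : Ck_on setT 2 f -> 0 < s ->
  exists r q : R, [/\ 0 < r < s, 0 < q < s &
    f (s *: u + (s *: v + p)) - f (s *: v + p) - (f (s *: u + p) - f p) =
    s * s * 'D_v ('D_u f) (q *: v + (r *: u + p))].
Proof.
move=> [df Df] s0.
have dfu p' w : derivable f p' w by apply: diff_derivable; exact: df.
have dshift p' : is_derive p' u (fun p => f (s *: v + p)) ('D_u f (s *: v + p')).
  have e : (fun h : R => h^-1 *: (f (s *: v + (h *: u + p')) - f (s *: v + p'))) =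
    (fun h : R => h^-1 *: (f (h *: u + (s *: v + p')) - f (s *: v + p'))).
    by apply/funext => h; rewrite addrCA.
  split; rewrite /derivable /derive /= e //.
  exact: dfu.
have dg p' : is_derive p' u ((fun p => f (s *: v + p)) - f)
    ('D_u f (s *: v + p') - 'D_u f p').
  by apply: is_deriveB; apply: derivableP.
have [r rs] := @MVT_line _ p u s (fun p' => @ex_derive _ _ _ _ _ _ _ (dg p')) s0.
rewrite (@derive_val _ _ _ _ _ _ _ (dg _)) => E.
have [p'|q qs E2] := @MVT_line ('D_u f) (r *: u + p) v s _ s0.
  by apply: diff_derivable; have [+ _] := Df u; apply.
exists r, q; split => //; rewrite -mulrA -E2 -E.
by rewrite /= !fctE [s *: v + (s *: u + p)]addrCA; ring.
Qed.

(** Schwarz's theorem. The second difference is symmetric in [u] and [v], so the two mixed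
    derivatives agree at points arbitrarily close to [p]; continuity carries this to [p]. *)
Lemma derive_comm f u v p : Ck_on setT 2 f ->
  'D_u ('D_v f) p = 'D_v ('D_u f) p.
Proof.
move=> Cf; apply/eqP; rewrite eq_le.
suff le_D u' v' : 'D_u' ('D_v' f) p <= 'D_v' ('D_u' f) p.
  by apply/andP; split; exact: le_D.
move=> {u v}; set u := u'; set v := v'.
have cont w w' : {for p, continuous ('D_w ('D_w' f))}.
  by case: Cf => _ /(_ w') [_ /(_ w)]; apply.
apply/ler_addgt0Pr => e e0.
have e20 : 0 < e / 2 by rewrite divr_gt0.
have /cvgrPdist_lt/(_ _ e20)/nbhs_ballP[d1 /= d10 B1] := cont u v.
have /cvgrPdist_lt/(_ _ e20)/nbhs_ballP[d2 /= d20 B2] := cont v u.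
pose d := Num.min d1 d2.
have d0 : 0 < d by rewrite lt_min d10.
(* With [s = d / K], steps shorter than [s] along both vectors stay within [d] of [p]; the summand 1
   keeps [K] positive. *)
pose K := `|u| + `|v| + 1.
have K0 : 0 < K by rewrite ltr_wpDl // addr_ge0.
pose s := d / K; have s0 : 0 < s by rewrite divr_gt0.
have near_p (r q : R) w w' : `|w| + `|w'| + 1 = K -> 0 < r < s -> 0 < q < s ->
    ball p d (q *: w' + (r *: w + p)).
  move=> wK /andP[r0 rs] /andP[q0 qs].
  rewrite -ball_normE /= addrA opprD addrCA subrr addr0 normrN.
  apply: le_lt_trans (ler_normD _ _) _; rewrite !normrZ !gtr0_norm //.
  have -> : d = s * K by rewrite divfK // gt_eqF.
  rewrite -wK mulrDr mulr1 mulrDr [s * `|w| + _]addrC.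
  apply: le_lt_trans (_ : _ <= s * `|w'| + s * `|w|) _; last by rewrite ltrDl.
  by apply: lerD; rewrite ler_wpM2r // ltW.
have [r [q [rs qs E1]]] := @MVT2_line f p u v s Cf s0.
have [r' [q' [rs' qs' E2]]] := @MVT2_line f p v u s Cf s0.
(* Both sides times [s * s] are the same second difference. *)
have E : 'D_u ('D_v f) (q' *: u + (r' *: v + p)) =
    'D_v ('D_u f) (q *: v + (r *: u + p)).
  apply: (@mulfI _ (s * s)); first by rewrite mulf_neq0 // gt_eqF.
  by rewrite -E1 -E2 [s *: v + (s *: u + p)]addrCA; ring.
have /B1 /= : ball p d1 (q' *: u + (r' *: v + p)).
  apply: (@le_ball _ _ p d); first by rewrite ge_min lexx.
  by apply: near_p => //; rewrite /K [`|v| + _]addrC.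
have /B2 /= : ball p d2 (q *: v + (r *: u + p)).
  apply: (@le_ball _ _ p d); first by rewrite ge_min lexx orbT.
  exact: near_p.
rewrite E; move: ('D_u ('D_v f) p) ('D_v ('D_u f) p) ('D_v ('D_u f) _).
clear -e; move=> x y z; rewrite !ltr_norml => /andP[? ?] /andP[? ?]; lra.
Qed.

End Calculus.

(** * Regularity and derivatives of the coordinates of a matrix-valued map *)

Section Coordinates.
Variables (R : realType) (V : normedModType R) (m n : nat).
Implicit Types (M : V -> 'M[R]_(m.+1, n.+1)).

Lemma derive_coord M p v i j : derivable M p v ->
  'D_v (fun q => M q i j) p = ('D_v M p) i j.
Proof. by move=> dM; rewrite derive_mx // mxE. Qed.

Lemma Ck_on_coord M k i j : Ck_on setT k M -> Ck_on setT k (fun q => M q i j).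
Proof.
elim: k M => [|k IH] M /=.
  move=> cM p _.
  apply: (@continuous_comp _ _ _ M (fun N : 'M[R]_(m.+1, n.+1) => N i j)).
    exact: cM.
  exact: coord_continuous.
move=> [dM DM]; split=> [p _|v].
  apply: (@differentiable_comp _ _ _ _ M (fun N : 'M[R]_(m.+1, n.+1) => N i j)).
    exact: dM.
  exact: differentiable_coord.
rewrite (_ : 'D_v _ = (fun q => ('D_v M q) i j)); first exact: IH.
by apply/funext => p; rewrite derive_coord //; apply/diff_derivable/dM.
Qed.

End Coordinates.

(** * Pseudohermitian maps in coordinates *)

Section Pseudohermitian.
Variable R : realType.
Implicit Types (p u v : H1 R).

Local Notation X := (vec3 (1 : R) 0 0).
Local Notation Y := (vec3 (0 : R) 1 0).
Local Notation T := (vec3 (0 : R) 0 1).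

(* The ascription keeps arithmetic on derivatives in [R] itself rather than in
   [R] viewed as a normed module. *)
Local Notation D v f p := ('D_v f p : R) (only parsing).

Lemma is_derive_coord p v j : is_derive p v (fun q : H1 R => q 0 j) (v 0 j).
Proof.
have [d E] := is_derive_id p v; split; first exact: ((derivable_mxP _ _ _).1 d).
by rewrite derive_coord // E.
Qed.

Lemma derive_frame (f : H1 R -> R) p v : differentiable f p ->
  D v f p = xc v * D X f p + yc v * D Y f p + zc v * D T f p.
Proof.
move=> df; rewrite !deriveE //.
have {1}-> : v = xc v *: X + yc v *: Y + zc v *: T.
  rewrite [LHS]vec3P; apply/rowP => i; rewrite !mxE.
  by case: i => [[|[|[|//]]] lt_i3] /=; ring.
by rewrite !linearD !linearZ.
Qed.

(** Subtracting [r * xc p + s * yc p] leaves a function all of whose directional derivatives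
    vanish. *)
Lemma derive_cst_affine (k : H1 R -> R) (r s : R) :
  (forall p, differentiable k p) ->
  (forall p, [/\ D X k p = r, D Y k p = s & D T k p = 0]) ->
  forall p, k p = r * xc p + s * yc p + k 0.
Proof.
move=> dk Dk p.
have dres q v := is_deriveB (diff_is_derive v (dk q))
  (is_deriveD (is_deriveZ r (is_derive_coord q v 0))
              (is_deriveZ s (is_derive_coord q v 1))).
have dres0 q v : D v k q - (r * xc v + s * yc v) = 0.
  by rewrite derive_frame //; have [-> -> ->] := Dk q; ring.
have E : k p - (r * xc p + s * yc p) = k 0 - (r * xc 0 + s * yc 0) :=
  derive_eq0_cst (fun q v => is_derive_eq (dres q v) (dres0 q v)) p 0.
rewrite -[LHS](subrK (r * xc p + s * yc p)) E /xc /yc !mxE; ring.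
Qed.

(** The vector [(c, d)] is orthogonal to the orthonormal basis [(a, b)], [(b, - a)], so its
    expansion in that basis is zero. *)
Lemma unit_orthogonal (a b c d : R) : a * a + b * b = 1 ->
  a * c + a * c + (b * d + b * d) = 0 ->
  a * - d + a * - d + (b * c + b * c) = 0 -> c = 0 /\ d = 0.
Proof.
move=> ab cd cd'.
have cd0 : a * c + b * d = 0 by lra.
have cd'0 : b * c - a * d = 0 by lra.
split; rewrite -[LHS]mulr1 -ab.
  transitivity (a * (a * c + b * d) + b * (b * c - a * d)); first by ring.
  by rewrite cd0 cd'0; ring.
transitivity (b * (a * c + b * d) - a * (b * c - a * d)); first by ring.
by rewrite cd0 cd'0; ring.
Qed.

(** * Rigidity: the planar components of a pseudohermitian map form a rotation and a translation *)

Section ContactComponents.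
Variables f g h : H1 R -> R.
Hypotheses (Cf : Ck_on setT 2 f) (Cg : Ck_on setT 2 g) (Ch : Ck_on setT 2 h).
Hypothesis contact : forall p v,
  D v h p + f p * D v g p - g p * D v f p = theta0 p v.
(** The first two coordinates of the commutation with [J0], evaluated on [e1]: Cauchy-Riemann
    equations along the contact frame. *)
Hypothesis commuteJ : forall p, D (e2 p) f p = - D (e1 p) g p /\
  D (e2 p) g p = D (e1 p) f p.

Let df p : differentiable f p. Proof. exact: Cf.1. Qed.
Let dg p : differentiable g p. Proof. exact: Cg.1. Qed.
Let dDf p v : differentiable ('D_v f) p. Proof. exact: (Cf.2 v).1. Qed.
Let dDg p v : differentiable ('D_v g) p. Proof. exact: (Cg.2 v).1. Qed.
Let dDh p v : differentiable ('D_v h) p. Proof. exact: (Ch.2 v).1. Qed.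

(* The exterior derivative of the contact identity. *)
Let symplectic p u v : D u f p * D v g p - D v f p * D u g p =
  xc u * yc v - yc u * xc v.
Proof.
(* The contact identity for the constant vector [v'], differentiated along [u']. *)
have key u' v' : D u' ('D_v' h) p + (f p * D u' ('D_v' g) p + D v' g p * D u' f p)
   - (g p * D u' ('D_v' f) p + D v' f p * D u' g p)
   = xc u' * yc v' - yc u' * xc v'.
  have L := is_deriveB (is_deriveD (diff_is_derive u' (dDh p v'))
     (is_deriveM (diff_is_derive u' (df p)) (diff_is_derive u' (dDg p v'))))
     (is_deriveM (diff_is_derive u' (dg p)) (diff_is_derive u' (dDf p v'))).
  have Rr := is_deriveB (is_deriveD (is_derive_cst (zc v') p u')
    (is_deriveZ (yc v') (is_derive_coord p u' 0)))
    (is_deriveZ (xc v') (is_derive_coord p u' 1)).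
  transitivity (0 + yc v' * xc u' - xc v' * yc u'); last by ring.
  apply: (is_derive_unique L Rr) => q.
  transitivity (zc v' + yc v' * xc q - xc v' * yc q); last by [].
  by rewrite !fctE contact /theta0; ring.
(* Antisymmetrizing cancels the second derivatives and leaves twice the claim. *)
have := key u v; have := key v u.
rewrite (derive_comm v u p Ch) (derive_comm v u p Cf) (derive_comm v u p Cg).
move: (D u ('D_v h) p) (D u ('D_v f) p) (D u ('D_v g) p).
move: (D u f p) (D v f p) (D u g p) (D v g p) => *; lra.
Qed.

(** By [symplectic], the derivative of [(f, g)] along [T] is parallel to those along [X] and [Y].
    These two have determinant 1, so it vanishes. *)
Let DT0 p : D T f p = 0 /\ D T g p = 0.
Proof.
have := symplectic p X Y; have := symplectic p X T; have := symplectic p Y T.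
rewrite !vec3E !(mul0r, mulr0, mul1r, subr0).
move: (D X f p) (D Y f p) (D T f p) (D X g p) (D Y g p) (D T g p).
move=> a b c a' b' c' YT XT XY; split.
  (* Multiplying by the determinant, which is 1, brings in products that the parallelism relations
     make cancel. *)
  rewrite -[LHS]mulr1 -XY.
  transitivity (a * (b' * c) - b * (a' * c)); first by ring.
  have -> : b' * c = b * c' by rewrite mulrC; apply/esym/eqP; rewrite -subr_eq0 YT.
  have -> : a' * c = a * c' by rewrite mulrC; apply/esym/eqP; rewrite -subr_eq0 XT.
  by ring.
rewrite -[LHS]mulr1 -XY.
transitivity (b' * (a * c') - a' * (b * c')); first by ring.
have -> : b * c' = c * b' by apply/eqP; rewrite -subr_eq0 YT.
have -> : a * c' = c * a' by apply/eqP; rewrite -subr_eq0 XT.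
by ring.
Qed.

(** [e1] and [e2] differ from [X] and [Y] by multiples of [T], along which [f] and [g] have zero
    derivative. *)
Let cauchy_riemann p : D Y f p = - D X g p /\ D Y g p = D X f p.
Proof.
have := commuteJ p.
rewrite !(derive_frame (e1 p)) // !(derive_frame (e2 p)) // !vec3E.
have [-> ->] := DT0 p.
move: (D X f p) (D Y f p) (D X g p) (D Y g p) => a b c d [bc da].
split; [transitivity (0 * a + 1 * b + - xc p * 0)
       |transitivity (0 * c + 1 * d + - xc p * 0)].
- by ring.
- by rewrite bc; ring.
- by ring.
- by rewrite da; ring.
Qed.

(** The Jacobian determinant is 1, and the Cauchy-Riemann equations turn it into this sum of
    squares. *)
Let unit_speed p : D X f p * D X f p + D X g p * D X g p = 1.
Proof.
have := symplectic p X Y; have [-> ->] := cauchy_riemann p.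
rewrite !vec3E => E; transitivity (1 * 1 - 0 * 0 : R); last by ring.
by rewrite -E; ring.
Qed.

(* [D_X f + i D_X g] is a holomorphic function of [x + i y] of modulus 1. *)
Let gradient_derive p v : D v ('D_X f) p = 0 /\ D v ('D_X g) p = 0.
Proof.
have fY : 'D_Y f = - 'D_X g by apply/funext => q; have [] := cauchy_riemann q.
have gY : 'D_Y g = 'D_X f by apply/funext => q; have [] := cauchy_riemann q.
have fT : 'D_T f = cst 0 by apply/funext => q; have [] := DT0 q.
have gT : 'D_T g = cst 0 by apply/funext => q; have [] := DT0 q.
have fXT : D T ('D_X f) p = 0 by rewrite (derive_comm _ _ _ Cf) fT derive_cst.
have gXT : D T ('D_X g) p = 0 by rewrite (derive_comm _ _ _ Cg) gT derive_cst.
have fXY : D Y ('D_X f) p = - D X ('D_X g) p.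
  by rewrite (derive_comm _ _ _ Cf) fY deriveN //; exact: diff_derivable.
have gXY : D Y ('D_X g) p = D X ('D_X f) p.
  by rewrite (derive_comm _ _ _ Cg) gY.
have unit_derive u : D X f p * D u ('D_X f) p + D X f p * D u ('D_X f) p +
    (D X g p * D u ('D_X g) p + D X g p * D u ('D_X g) p) = 0.
  exact: (derive_unit_circle (diff_is_derive u (dDf p X))
    (diff_is_derive u (dDg p X)) unit_speed).
(* Differentiating the unit modulus along [X], and along [Y] through [fXY] and [gXY], gives the two
   orthogonality relations. *)
have [fXX gXX] : D X ('D_X f) p = 0 /\ D X ('D_X g) p = 0.
  apply: (unit_orthogonal (unit_speed p) (unit_derive X)).
  by rewrite -fXY -gXY; exact: unit_derive.
rewrite (derive_frame v (dDf p X)) (derive_frame v (dDg p X)).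
rewrite fXT gXT fXY gXY fXX gXX; split; ring.
Qed.

(** The derivatives along [X] are constants [a] and [b]; the Cauchy-Riemann equations give those
    along [Y], and those along [T] vanish. *)
Lemma contact_components_affine : exists a b c d : R, [/\ a * a + b * b = 1,
  forall p, f p = a * xc p - b * yc p + c &
  forall p, g p = b * xc p + a * yc p + d].
Proof.
pose a := D X f 0; pose b := D X g 0.
have fX p : D X f p = a.
  apply: (derive_eq0_cst (f := 'D_X f)) => q v.
  exact: is_derive_eq (diff_is_derive v (dDf q X)) (gradient_derive q v).1.
have gX p : D X g p = b.
  apply: (derive_eq0_cst (f := 'D_X g)) => q v.
  exact: is_derive_eq (diff_is_derive v (dDg q X)) (gradient_derive q v).2.
exists a, b, (f 0), (g 0); split => [|p|p]; first exact: unit_speed.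
- rewrite -mulNr; apply: derive_cst_affine => // q; split; first exact: fX.
    by rewrite (cauchy_riemann q).1 gX.
  exact: (DT0 q).1.
- apply: derive_cst_affine => // q; split; first exact: gX.
    by rewrite (cauchy_riemann q).2 fX.
  exact: (DT0 q).2.
Qed.

End ContactComponents.
End Pseudohermitian.

(** * Planar part of a pseudohermitian map; rotations and left translations as elements of PSH(1) *)

Section HeisenbergMotions.
Variable R : realType.
Implicit Types (p v c : H1 R) (Phi : H1 R -> H1 R) (a b : R).

Lemma PSH1_proj Phi : PSH1 Phi -> exists a b x y : R, [/\ a * a + b * b = 1,
  forall p, xc (Phi p) = a * xc p - b * yc p + x &
  forall p, yc (Phi p) = b * xc p + a * yc p + y].
Proof.
move=> [[smooth_Phi _] contact commuteJ].
have CPhi : Ck_on setT 2 Phi := smooth_Phi 2.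
have dPhi p v : derivable Phi p v by apply: diff_derivable; exact: CPhi.1.
have dE p v : 'd Phi p v = 'D_v Phi p by rewrite deriveE //; exact: CPhi.1.
have DE p v i : 'D_v (fun q => Phi q 0 i) p = ('D_v Phi p) 0 i by exact: derive_coord.
apply: (contact_components_affine (f := fun q => xc (Phi q))
  (g := fun q => yc (Phi q)) (h := fun q => zc (Phi q))).
- exact: Ck_on_coord.
- exact: Ck_on_coord.
- exact: Ck_on_coord.
- by move=> p v; rewrite !DE -contact dE.
- move=> p; have e1_xi0 : xi0 p (e1 p) by rewrite /xi0 /= /theta0 !vec3E; ring.
  rewrite !DE; have := commuteJ p _ e1_xi0; rewrite J0_e1 !dE => ->.
  by rewrite /J0 /xc /yc !mxE /=; split; ring.
Qed.

Lemma differentiable_mulmxr m n (L : 'M[R]_(m.+1, n.+1)) (p : 'rV[R]_m.+1) :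
  differentiable (mulmxr L) p.
Proof.
rewrite (_ : mulmxr L = \sum_i (fun q : 'rV[R]_m.+1 => q 0 i *: row i L)).
  by apply: differentiable_sum => i; apply/differentiableZl/differentiable_coord.
by apply/funext => q; rewrite fct_sumE /= mulmx_sum_row.
Qed.

Lemma is_diff_affine m n (L : 'M[R]_(m.+1, n.+1)) (c : 'rV[R]_n.+1)
  (p : 'rV[R]_m.+1) : is_diff p (fun q => q *m L + c) (mulmxr L).
Proof.
have cL : continuous (mulmxr L : 'rV[R]_m.+1 -> _).
  by move=> q; exact/differentiable_continuous/differentiable_mulmxr.
have dL : is_diff p (mulmxr L) (mulmxr L).
  by split; [exact: differentiable_mulmxr|exact: diff_lin].
have := is_diffD dL (is_diff_cst c p).
by rewrite addr0.
Qed.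

Lemma Ck_on_cst (V W : normedModType R) (U : set V) (w : W) k : Ck_on U k (cst w).
Proof.
elim: k w => [|k IH] w /=; first by move=> x _; exact: cst_continuous.
split=> [x _|v]; first exact: differentiable_cst.
by rewrite (_ : 'D_v _ = cst 0) //; apply/funext => x; exact: derive_cst.
Qed.

(** Each first directional derivative is constant, so the higher ones are covered by [Ck_on_cst]. *)
Lemma smooth_on_affine m n (L : 'M[R]_(m.+1, n.+1)) (c : 'rV[R]_n.+1) U :
  smooth_on U (fun q : 'rV[R]_m.+1 => q *m L + c).
Proof.
have dA x := is_diff_affine L c x.
case=> [|k] /=.
  by move=> x _; apply: differentiable_continuous; case: (dA x).
split=> [x _|w]; first by case: (dA x).
rewrite (_ : 'D_w _ = cst (w *m L)); first exact: Ck_on_cst.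
by apply/funext => x; have [d E] := dA x; rewrite deriveE // E.
Qed.

(* A rotation about the z-axis followed by a left translation. *)
Definition heis_motion a b c p : H1 R :=
  heis_mul c (vec3 (a * xc p - b * yc p) (b * xc p + a * yc p) (zc p)).

(** The linear part, acting on row vectors from the right: the first two columns rotate, and the
    third adds the group law's shear term for [c] and the rotated point. *)
Definition heis_motion_mx a b c : 'M[R]_3 := \matrix_(i < 3)
  [:: vec3 a b (yc c * a - xc c * b); vec3 (- b) a (- yc c * b - xc c * a);
      vec3 0 0 1]`_i.

Lemma mul_heis_motion_mx a b c p : p *m heis_motion_mx a b c =
  vec3 (a * xc p - b * yc p) (b * xc p + a * yc p)
    (zc p + yc c * (a * xc p - b * yc p) - xc c * (b * xc p + a * yc p)).
Proof.
rewrite {1}[p]vec3P; apply/rowP => j; rewrite !mxE !big_ord_recl big_ord0 !mxE /=.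
by case: j => [[|[|[|//]]] lt_j3] /=; rewrite ?mxE /=; ring.
Qed.

Lemma heis_motion_affine a b c p :
  heis_motion a b c p = p *m heis_motion_mx a b c + c.
Proof.
rewrite mul_heis_motion_mx [X in _ = _ + X]vec3P /heis_motion /heis_mul !vec3E.
by apply/rowP => j; rewrite !mxE; case: j => [[|[|[|//]]] lt_j3] /=; ring.
Qed.

(** A rotation is a group automorphism and group inversion is negation, so the inverse motion
    rotates back and then translates by the back-rotated [- c], which is [c']. Constraining [c'] by
    coordinates lets one lemma serve both orders of composition. *)
Lemma heis_motionK a b c c' : a * a + b * b = 1 ->
  xc c' = - (a * xc c + b * yc c) -> yc c' = b * xc c - a * yc c ->
  zc c' = - zc c -> cancel (heis_motion a b c) (heis_motion a (- b) c').
Proof.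
move=> ab cx cy cz p; rewrite [RHS]vec3P /heis_motion /heis_mul !vec3E cx cy cz.
congr vec3.
- by rewrite -[RHS]mul1r -ab; ring.
- by rewrite -[RHS]mul1r -ab; ring.
- transitivity (zc p + (1 - (a * a + b * b)) *
    (yc c * (a * xc p - b * yc p) - xc c * (b * xc p + a * yc p))); first by ring.
  by rewrite ab; ring.
Qed.

Lemma PSH1_heis_motion a b c : a * a + b * b = 1 -> PSH1 (heis_motion a b c).
Proof.
move=> ab; pose Phi := heis_motion a b c.
have smooth a' b' c' : smooth_on setT (heis_motion a' b' c').
  rewrite (_ : heis_motion a' b' c' = fun p => p *m heis_motion_mx a' b' c' + c').
    exact: smooth_on_affine.
  by apply/funext => p; exact: heis_motion_affine.
have dPhi p v : 'd Phi p v = v *m heis_motion_mx a b c.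
  have [_] := is_diff_affine (heis_motion_mx a b c) c p.
  rewrite (_ : (fun q => _) = Phi); first by move=> ->.
  by apply/funext => q; rewrite -heis_motion_affine.
split.
- split; first exact: smooth.
  pose c' := vec3 (- (a * xc c + b * yc c)) (b * xc c - a * yc c) (- zc c).
  exists (heis_motion a (- b) c'); last exact: smooth.
  split; first by apply: heis_motionK; rewrite ?vec3E.
  (* The other composition is the same lemma with [- b] for [b] and the roles of [c] and [c']
     exchanged. *)
  rewrite -{2}[b]opprK; apply: heis_motionK; rewrite ?vec3E.
  + by rewrite mulrNN.
  + by rewrite -[LHS]mul1r -ab; ring.
  + by rewrite -[LHS]mul1r -ab; ring.
  + by rewrite opprK.
- move=> p v; rewrite dPhi mul_heis_motion_mx /theta0 /Phi /heis_motion /heis_mul.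
  (* The shear from the translation cancels, and the rotation multiplies [x dy - y dx] by its
     determinant. *)
  rewrite !vec3E; transitivity (zc v + (a * a + b * b) * (xc p * yc v - yc p * xc v)).
    by ring.
  by rewrite ab; ring.
- move=> p v _; rewrite !dPhi !mul_heis_motion_mx /J0 /Phi /heis_motion /heis_mul.
  apply/rowP => j; rewrite /e1 /e2 !vec3E !mxE /xc /yc /zc !mxE /=.
  case: j => [[|[|[|//]]] lt_j3] /=; try ring.
  (* Only the z-coordinate remains; it is rearranged so that [a * a + b * b] appears as a factor. *)
  transitivity (- (a * a + b * b) * (v 0 0 * p 0 0 + v 0 1 * p 0 1)
    - (c 0 1 * (b * v 0 0 + a * v 0 1) + c 0 0 * (a * v 0 0 - b * v 0 1))); last by ring.
  by rewrite ab; ring.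
Qed.

(** * Rotations of the plane *)

Lemma det_mx22 (M : 'M[R]_2) : \det M = M 0 0 * M 1 1 - M 0 1 * M 1 0.
Proof.
rewrite (expand_det_row _ 0) !big_ord_recl big_ord0 /cofactor !det_mx11 !mxE.
rewrite /= !expr0 !expr1 mul1r addr0 mulN1r mulrN.
by congr (_ * M _ _ - M _ _ * M _ _); exact: val_inj.
Qed.

(** The two rows have squared norm 1 and the determinant is 1, so the squares of [M 1 1 - M 0 0] and
    [M 1 0 + M 0 1] add up to 1 + 1 - 2 = 0. *)
Lemma rotation_entries (M : 'M[R]_2) : M *m M^T = 1%:M -> \det M = 1 ->
  [/\ M 0 0 * M 0 0 + M 0 1 * M 0 1 = 1, M 1 0 = - M 0 1 & M 1 1 = M 0 0].
Proof.
move=> MM detM.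
have row i : M i 0 * M i 0 + M i 1 * M i 1 = 1.
  have := congr1 (fun N : 'M[R]_2 => N i i) MM.
  rewrite !mxE eqxx !big_ord_recl big_ord0 !mxE addr0.
  by rewrite (_ : lift _ _ = 1) //; exact: val_inj.
have row0 := row 0; have row1 := row 1.
have det : M 0 0 * M 1 1 - M 0 1 * M 1 0 = 1 by rewrite -detM det_mx22.
have sq0 : (M 1 1 - M 0 0) ^+ 2 + (M 1 0 + M 0 1) ^+ 2 = 0.
  transitivity (M 0 0 * M 0 0 + M 0 1 * M 0 1 + (M 1 0 * M 1 0 + M 1 1 * M 1 1)
    - 2 * (M 0 0 * M 1 1 - M 0 1 * M 1 0)); first by ring.
  by rewrite row0 row1 det; ring.
move/eqP: sq0; rewrite paddr_eq0 ?sqr_ge0 // !sqrf_eq0 subr_eq0 addr_eq0.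
by move=> /andP[/eqP ? /eqP ?].
Qed.

(** Arranged for row vectors: [(x, y)] goes to [(a x - b y, b x + a y)], as in [heis_motion]. *)
Definition rotation_mx a b : 'M[R]_2 := \matrix_(i < 2, j < 2)
  (if i == 0 then [:: a; b] else [:: - b; a])`_j.

Lemma euclidean_rotation a b (c : 'rV[R]_2) : a * a + b * b = 1 ->
  euclidean_rigid_motion (fun q => q *m rotation_mx a b + c).
Proof.
move=> ab; exists (rotation_mx a b), c; split=> //.
  apply/matrixP => i j; rewrite !mxE !big_ord_recl big_ord0 !mxE /=.
  case: i => [[|[|//]] lt_i2]; case: j => [[|[|//]] lt_j2] /=;
    rewrite ?mulr1n ?mulr0n; first [by rewrite -ab; ring | ring].
by rewrite det_mx22 !mxE /= -ab; ring.
Qed.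

End HeisenbergMotions.

(** * Curves, their projections and horizontal lifts *)

Section Curves.
Variable R : realType.
Implicit Types (a b : \bar R) (gamma : R -> H1 R).

Lemma near_oitv a b t : oitv a b t -> \forall s \near t, oitv a b s.
Proof.
move=> /andP[at_ tb].
have na : \forall s \near t, (a < s%:E)%E.
  case: a at_ => [r||]; rewrite ?lte_fin //.
    by move=> rt; near=> s; rewrite lte_fin; near: s; exact: lt_nbhsr.
  by move=> _; near=> s; rewrite ltNyr.
have nb : \forall s \near t, (s%:E < b)%E.
  case: b tb => [r||]; rewrite ?lte_fin //.
    by move=> rt; near=> s; rewrite lte_fin; near: s; exact: lt_nbhsl.
  by move=> _; near=> s; rewrite ltry.
by near=> s; apply/andP; split; near: s.
Unshelve. all: by end_near. Qed.

(** The derivative is controlled only inside the interval, so the mean value theorem is applied on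
    the segment between the two points, which lies inside. *)
Lemma derive0_oitv_cst a b (f : R -> R) :
  (forall t, oitv a b t -> is_derive t 1 f 0) ->
  forall s t, oitv a b s -> oitv a b t -> f s = f t.
Proof.
move=> df.
suff le_cst s t : s <= t -> oitv a b s -> oitv a b t -> f s = f t.
  move=> s t os ot; case: (leP s t) => [st|/ltW ts]; first exact: le_cst.
  exact/esym/le_cst.
move=> st /andP[as_ _] /andP[_ tb].
have df_st x : x \in `[s, t] -> is_derive x 1 f 0.
  rewrite in_itv /= => /andP[sx xt]; apply: df; apply/andP; split.
    by apply: lt_le_trans as_ _; rewrite lee_fin.
  by apply: le_lt_trans tb; rewrite lee_fin.
have cf : {within `[s, t], continuous f}.
  by apply: derivable_within_continuous => x /df_st[].
have df_oo x : x \in `]s, t[ -> is_derive x 1 f 0.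
  by move=> /subset_itv_oo_cc; exact: df_st.
have [c _ E] := MVT_segment st df_oo cf.
by apply/esym/eqP; rewrite -subr_eq0 E mul0r.
Qed.

Lemma smooth_is_derive a b gamma t i : smooth_on (oitv a b) gamma -> oitv a b t ->
  is_derive t 1 (fun s => gamma s 0 i) (derive1 gamma t 0 i).
Proof.
move=> /(_ 1) [dgamma _] ot.
have dt : derivable gamma t 1 by apply/diff_derivable/dgamma.
split; first exact: ((derivable_mxP _ _ _).1 dt).
by rewrite derive_coord // derive1E.
Qed.

Lemma horizontal_theta0 a b gamma t : horizontal a b gamma -> oitv a b t ->
  theta0 (gamma t) (derive1 gamma t) = 0.
Proof. by move=> hor ot; rewrite hor //; exact: xi0_part_xi0. Qed.

(* A horizontal curve is the lift of its projection, [z' = y x' - x y'], and the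
   motion maps horizontal lifts to horizontal lifts. *)
Lemma derive_horizontal_lifts (x1 y1 z1 x2 y2 z2 : R -> R) (r s c d t : R)
    (dx1 dy1 dz1 dx2 dy2 dz2 : R) :
  r * r + s * s = 1 ->
  (\forall u \near t, r * x1 u - s * y1 u + c = x2 u) ->
  (\forall u \near t, s * x1 u + r * y1 u + d = y2 u) ->
  is_derive t 1 x1 dx1 -> is_derive t 1 y1 dy1 -> is_derive t 1 z1 dz1 ->
  is_derive t 1 x2 dx2 -> is_derive t 1 y2 dy2 -> is_derive t 1 z2 dz2 ->
  dz1 + x1 t * dy1 - y1 t * dx1 = 0 -> dz2 + x2 t * dy2 - y2 t * dx2 = 0 ->
  is_derive t 1 (fun u => z2 u - (z1 u + d * (r * x1 u - s * y1 u)
    - c * (s * x1 u + r * y1 u))) 0.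
Proof.
move=> rs nx ny Dx1 Dy1 Dz1 Dx2 Dy2 Dz2 h1 h2.
have DX : is_derive t 1 (fun u => r * x1 u - s * y1 u) (r * dx1 - s * dy1) :=
  is_deriveB (is_deriveZ r Dx1) (is_deriveZ s Dy1).
have DY : is_derive t 1 (fun u => s * x1 u + r * y1 u) (s * dx1 + r * dy1) :=
  is_deriveD (is_deriveZ s Dx1) (is_deriveZ r Dy1).
(* Near [t] the second projection is the moved first one, so uniqueness of derivatives expresses
   [dx2] and [dy2] through [dx1] and [dy1]. *)
have Dx2' : is_derive t 1 x2 (r * dx1 - s * dy1 + 0) :=
  near_eq_is_derive nx (is_deriveD DX (is_derive_cst c t 1)).
have Dy2' : is_derive t 1 y2 (s * dx1 + r * dy1 + 0) :=
  near_eq_is_derive ny (is_deriveD DY (is_derive_cst d t 1)).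
have Ex : dx2 = r * dx1 - s * dy1 by rewrite (is_derive_unique Dx2 Dx2') // addr0.
have Ey : dy2 = s * dx1 + r * dy1 by rewrite (is_derive_unique Dy2 Dy2') // addr0.
have Ext : x2 t = r * x1 t - s * y1 t + c by rewrite -(nbhs_singleton nx).
have Eyt : y2 t = s * x1 t + r * y1 t + d by rewrite -(nbhs_singleton ny).
apply: (is_derive_eq (is_deriveB Dz2
  (is_deriveB (is_deriveD Dz1 (is_deriveZ d DX)) (is_deriveZ c DY)))).
transitivity (dz2 - (dz1 + d * (r * dx1 - s * dy1) - c * (s * dx1 + r * dy1))).
  by [].
have -> : dz1 = y1 t * dx1 - x1 t * dy1 by lra.
have -> : dz2 = y2 t * dx2 - x2 t * dy2 by lra.
rewrite Ex Ey Ext Eyt.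
(* The terms in [c] and [d] cancel; the rotation multiplies [y dx - x dy] by [r * r + s * s]. *)
transitivity ((r * r + s * s - 1) * (y1 t * dx1 - x1 t * dy1)); first by ring.
by rewrite rs; ring.
Qed.

Lemma heisenberg_motion_proj a b gamma1 gamma2 :
  differ_by_heisenberg_motion a b gamma1 gamma2 ->
  differ_by_euclidean_motion a b (@proj_xy R \o gamma1) (@proj_xy R \o gamma2).
Proof.
case=> Phi /PSH1_proj [r [s [x [y [rs Ex Ey]]]]] E.
exists (fun q => q *m rotation_mx r s + \row_(i < 2) [:: x; y]`_i).
  exact: euclidean_rotation.
move=> t ot; rewrite /= E //; apply/rowP => j.
rewrite !mxE !big_ord_recl big_ord0 !mxE /= Ex Ey.
by case: j => [[|[|//]] lt_j2] /=; ring.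
Qed.

Lemma horizontal_euclidean_motion_lift a b gamma1 gamma2 :
  smooth_on (oitv a b) gamma1 -> smooth_on (oitv a b) gamma2 ->
  horizontal a b gamma1 -> horizontal a b gamma2 ->
  differ_by_euclidean_motion a b (@proj_xy R \o gamma1) (@proj_xy R \o gamma2) ->
  differ_by_heisenberg_motion a b gamma1 gamma2.
Proof.
move=> smooth1 smooth2 hor1 hor2 [E [M [v [MM detM EM]]] Egamma].
have [rs M10 M11] := rotation_entries MM detM.
move: rs M10 M11; set r := M 0 0; set s := M 0 1 => rs M10 M11.
have [Ex Ey] : (forall t, oitv a b t ->
    r * xc (gamma1 t) - s * yc (gamma1 t) + v 0 0 = xc (gamma2 t)) /\
    (forall t, oitv a b t ->
    s * xc (gamma1 t) + r * yc (gamma1 t) + v 0 1 = yc (gamma2 t)).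
  have coord t i : oitv a b t -> proj_xy (gamma2 t) 0 i =
      xc (gamma1 t) * M 0 i + yc (gamma1 t) * M 1 i + v 0 i.
    move=> ot; have /= -> := Egamma t ot.
    rewrite EM !mxE !big_ord_recl big_ord0 !mxE /= addr0.
    by congr (_ + yc _ * M _ _ + _); exact: val_inj.
  split=> t ot.
    by have := coord t 0 ot; rewrite mxE /= M10 -/r => ->; ring.
  by have := coord t 1 ot; rewrite mxE /= M11 -/s => ->; ring.
(* The height of [gamma2] above the image of [gamma1] under the lifted motion with zero vertical
   translation. *)
pose w t := zc (gamma2 t) - (zc (gamma1 t)
  + v 0 1 * (r * xc (gamma1 t) - s * yc (gamma1 t))
  - v 0 0 * (s * xc (gamma1 t) + r * yc (gamma1 t))).
have dw t : oitv a b t -> is_derive t 1 w 0.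
  move=> ot; have D1 i := smooth_is_derive i smooth1 ot.
  have D2 i := smooth_is_derive i smooth2 ot.
  apply: (derive_horizontal_lifts rs _ _ (D1 0) (D1 1) (D1 2) (D2 0) (D2 1) (D2 2)).
  - by apply: filterS (near_oitv ot) => u; exact: Ex.
  - by apply: filterS (near_oitv ot) => u; exact: Ey.
  - exact: horizontal_theta0 hor1 ot.
  - exact: horizontal_theta0 hor2 ot.
(* A base point fixes the constant; over an empty interval any value serves. *)
have [k wk] : exists k, forall t, oitv a b t -> w t = k.
  have [[t0 ot0]|none] := pselect (exists t, oitv a b t).
    by exists (w t0) => t ot; exact: derive0_oitv_cst dw _ _ ot ot0.
  by exists 0 => t ot; case: none; exists t.
(* The vertical translation [k] makes up the constant height difference. *)
exists (heis_motion r s (vec3 (v 0 0) (v 0 1) k)); first exact: PSH1_heis_motion.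
move=> t ot; rewrite [LHS]vec3P /heis_motion /heis_mul !vec3E -Ex // -Ey // -(wk t ot).
by congr vec3; rewrite /w; ring.
Qed.

End Curves.

Theorem corollary1p6 (R : realType) (a b : \bar R) (gamma1 gamma2 : R -> H1 R)
    (ab : (a < b)%E)
    (smooth1 : smooth_on (oitv a b) gamma1)
    (smooth2 : smooth_on (oitv a b) gamma2) :
  (horizontally_regular a b gamma1 -> horizontally_regular a b gamma2 ->
   differ_by_heisenberg_motion a b gamma1 gamma2 ->
   differ_by_euclidean_motion a b
     (@proj_xy R \o gamma1) (@proj_xy R \o gamma2))
  /\
  (horizontal a b gamma1 -> horizontal a b gamma2 ->
   (differ_by_heisenberg_motion a b gamma1 gamma2 <->
    differ_by_euclidean_motion a b
      (@proj_xy R \o gamma1) (@proj_xy R \o gamma2))).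
Proof.
split=> [_ _|hor1 hor2]; first exact: heisenberg_motion_proj.
split; first exact: heisenberg_motion_proj.
exact: horizontal_euclidean_motion_lift.
Qed.
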